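(* Let $d\ge1$. The ideal $\mathcal I$ is generated by the elements $q_\Theta$, where $\Theta$ runs over the unimodular $d\times d$-submatrices of $\bigl(X_d^{(1)}\,|\,X_d^{(2)}\bigr)$.
   Context: $\Pi^d$ denotes the ring of polynomials in the variables $\boldsymbol z=(z_1,\dots,z_d)$ (real coefficients), and $\mathcal I=\{p\in\Pi^d:\ p(\varepsilon)=0\text{ for all }\varepsilon\in\{-1,+1\}^d\setminus\{(1,\dots,1)\}\}$, an ideal of $\Pi^d$. $X_d^{(1)}=I_d$ is the matrix whose columns are the standard unit vectors $e_1,\dots,e_d$, and $X_d^{(2)}$ is the matrix whose columns are the vectors $e_j+e_k$, $j\neq k$ (one column for each unordered pair). A $d\times d$-submatrix is obtained by selecting $d$ distinct columns; it is unimodular if $\det\Theta=\pm1$. For such $\Theta$, $q_\Theta(\boldsymbol z)=\prod_{\theta\in\Theta}\frac{1+\boldsymbol z^\theta}{2}$, where $\theta$ runs through the columns of $\Theta$ and $\boldsymbol z^\theta=z_1^{\theta_1}\cdots z_d^{\theta_d}$. *)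

(* Defs.v *)
From HB Require Import structures.
From mathcomp Require Import all_boot all_order all_algebra.
From mathcomp Require Import mpoly.
From mathcomp Require Import reals.

Set Implicit Arguments.
Unset Strict Implicit.
Unset Printing Implicit Defensive.

Import Order.TTheory GRing.Theory Num.Theory.
Local Open Scope ring_scope.

Definition vanishing_ideal (R : realType) (d : nat) (p : {mpoly R[d]}) : Prop :=
  forall eps : 'I_d -> R,
    (forall i, eps i = -1 \/ eps i = 1) ->
    ~ (forall i, eps i = 1) ->
    p.@[eps] = 0.

Definition generated_ideal (A : comNzRingType) (S : A -> Prop) (x : A) : Prop :=
  exists (n : nat) (a s : 'I_n -> A),
    (forall i, S (s i)) /\ x = \sum_(i < n) a i * s i.

(* The entries are natural numbers because the columns serve as exponents of
   monomials; determinants are taken after casting to int. *)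
Definition X1 (d : nat) : 'M[nat]_d := 1%:M.

(* An unordered pair {j, k} with j != k is represented by (j, k) with j < k. *)
Definition upair (d : nat) : finType := {jk : 'I_d * 'I_d | (jk.1 < jk.2)%N}.

Definition X2 (d : nat) : 'M[nat]_(d, #|upair d|) :=
  \matrix_(i, c) ((i == (val (enum_val c)).1) + (i == (val (enum_val c)).2))%N.

Definition X12 (d : nat) : 'M[nat]_(d, d + #|upair d|) := row_mx (X1 d) (X2 d).

(* The order of the selected columns is left free: it affects neither
   unimodularity nor the product q. *)
Definition column_submatrix (d n : nat) (X : 'M[nat]_(d, n)) (Theta : 'M[nat]_d)
    : Prop :=
  exists2 f : 'I_d -> 'I_n, injective f & Theta = colsub f X.

Definition unimodular (d : nat) (Theta : 'M[nat]_d) : Prop :=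
  let D := \det (map_mx Posz Theta) in D = 1 \/ D = -1.

Definition q (R : realType) (d : nat) (Theta : 'M[nat]_d) : {mpoly R[d]} :=
  \prod_(j < d) (2^-1 *: (1 + \prod_(i < d) 'X_i ^+ Theta i j)).

(* Main.v *)
Require Import Defs.
From HB Require Import structures.
From mathcomp Require Import all_boot all_order all_algebra.
From mathcomp Require Import mpoly.
From mathcomp Require Import reals.
From mathcomp Require Import fingroup perm ring.

Set Implicit Arguments.
Unset Strict Implicit.
Unset Printing Implicit Defensive.

Import Order.TTheory GRing.Theory Num.Theory.
Local Open Scope ring_scope.

(** Adjoin a vertex 0 with coordinate z_0 = 1 to the vertices 1, ..., d.  A
    column e_j then stands for the edge {0, j} and a column e_j + e_k for the
    edge {j, k}; both contribute the factor (1 + z_j z_k) / 2.  Trees spanning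
    {0, ..., d}, rooted at 0, give unimodular selections of columns: each
    vertex j contributes the edge to its parent, and along an order in which
    parents precede children the matrix is unitriangular.

    Every q_Theta vanishes on the punctured cube because an invertible integer
    matrix is invertible modulo 2: if all the signs eps^theta equal 1, so do
    all the eps_i ([unimodular_signs]).

    For the converse let J be the ideal generated by the q_Theta.  The key
    point is that 1 - z_v^2 is in J for every v ([one_sub_sqr_in_tree_ideal]).
    This is shown for (1 - z_v^2) times the product of the factors of any
    rooted forest, by induction on the number of trees that do not contain 0.
    If b and c are roots of two such trees, then
    2 = (1 + z_b z_c) + (1 + z_c) - z_c (1 + z_b),
    and each summand is a multiple of the factor of an edge that joins two
    trees.  If b is the only such root, either b = v and 1 - z_v^2 is a
    multiple of 1 + z_b, or 1 - z_v^2 is the multiple by 1 + z_v of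
    1 - z_v = (1 + z_b z_v) - z_v (1 + z_b).  Here the vertices are ordered
    with v first and parents always come before their children, so v lies in
    the tree of b only if v = b; otherwise {b, v} does join two trees.

    Modulo the 1 - z_i^2 every polynomial p is congruent to its Lagrange
    interpolant on the cube ([interpolation_mod_ideal] and
    [sum_cube_idempotent]).  If p vanishes off (1, ..., 1), only the multiple
    of the product of the (1 + z_i) / 2 is left, which is q_Theta for
    Theta = I_d. *)

(** * Ideals *)

Definition ideal (A : comNzRingType) (J : A -> Prop) : Prop :=
  [/\ J 0, forall x y, J x -> J y -> J (x + y) & forall a x, J x -> J (a * x)].

Lemma generated_ideal_ideal (A : comNzRingType) (S : A -> Prop) :
  ideal (generated_ideal S).
Proof.
split.
- by exists 0, (fun=> 0), (fun=> 0); split=> [[]//|]; rewrite big_ord0.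
- move=> x y [n [a [s [Ss ->]]]] [m [b [t [St ->]]]].
  exists (n + m)%N,
    (fun i => match split i with inl j => a j | inr j => b j end),
    (fun i => match split i with inl j => s j | inr j => t j end).
  split=> [i|]; first by case: split.
  rewrite big_split_ord /=; congr (_ + _); apply: eq_bigr => i _.
    by rewrite (unsplitK (inl _ i)).
  by rewrite (unsplitK (inr _ i)).
- move=> c x [n [a [s [Ss ->]]]]; exists n, (fun i => c * a i), s; split=> //.
  by rewrite mulr_sumr; apply: eq_bigr => i _; rewrite mulrA.
Qed.

Lemma mem_generated_ideal (A : comNzRingType) (S : A -> Prop) x :
  S x -> generated_ideal S x.
Proof.
by move=> Sx; exists 1, (fun=> 1), (fun=> x); rewrite big_ord1 mul1r.
Qed.

(** * Rooted trees *)

(** The value [None] stands for the parent 0, whose coordinate is 1. *)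
Definition edge (A : comNzRingType) (T : Type) (x : T -> A) (i : T)
    (o : option T) : A :=
  1 + x i * oapp x 1 o.

Definition parents_below (T : Type) (r : T -> nat) (p : T -> option T) : Prop :=
  forall i j, p i = Some j -> (r j < r i)%N.

(** Joining the tree rooted at [b] to a vertex of smaller rank. *)
Lemma join_root (A : comNzRingType) (T : finType) (x : T -> A) (r : T -> nat)
    (S : {set T}) (p : T -> option T) (b : T) (o : option T) :
    b \in S -> parents_below r p -> (forall j, o = Some j -> (r j < r b)%N) ->
  exists2 p', parents_below r p' &
    \prod_(i | i \notin S :\ b) edge x i (p' i)
      = edge x b o * \prod_(i | i \notin S) edge x i (p i).
Proof.
move=> bS pP oP; exists (fun i => if i == b then o else p i).
  by move=> i j; case: eqP => [->|_]; [apply: oP | apply: pP].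
rewrite (bigD1 b) /=; last by rewrite !inE eqxx.
rewrite eqxx; congr (_ * _); apply: eq_big => [i|i].
  by rewrite !inE; case: (eqVneq i b) => [->|_]; rewrite ?bS ?andbT ?andbF.
by case/andP=> _ /negbTE ->.
Qed.

(** In the induction, [S] is the set of the roots of those trees of a forest
    that do not contain 0, so that the product over the vertices outside [S]
    is the product over the edges of the forest.  The element [h] is the
    inverse of 2. *)
Lemma one_sub_sqr_in_tree_ideal (A : comNzRingType) (T : finType) (x : T -> A)
    (r : T -> nat) (v : T) (J : A -> Prop) (h : A) :
    ideal J -> h * 2 = 1 -> injective r ->
    (forall i, i != v -> (r v < r i)%N) ->
    (forall p, parents_below r p -> J (\prod_i edge x i (p i))) ->
  J (1 - x v ^+ 2).
Proof.
move=> [J0 JD JM] h2 r_inj rv Jtree.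
suff H n : forall (S : {set T}) p, #|S| = n.+1 -> parents_below r p ->
    J ((1 - x v ^+ 2) * \prod_(i | i \notin S) edge x i (p i)).
  have cT : #|[set: T]| = #|T|.-1.+1.
    by rewrite cardsT prednK //; apply/card_gt0P; exists v.
  have := H _ _ (fun=> None) cT; rewrite big_pred0 => [|i]; last by rewrite inE.
  by rewrite mulr1; apply.
have none_below b j : None = Some j -> (r j < r b)%N by [].
elim: n => [|n IHn] S p cS pP.
  have /cards1P [b Sb] : #|S| == 1%N by rewrite cS.
  have bS : b \in S by rewrite Sb set11.
  set Q := \prod_(i | _) _.
  have Jedge o : (forall j, o = Some j -> (r j < r b)%N) -> J (edge x b o * Q).
    move=> /(join_root x bS pP) [p' p'P <-]; rewrite Sb setDv.
    under eq_bigl do rewrite inE.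
    exact: Jtree.
  have := Jedge None (none_below b); rewrite /edge /= mulr1 => J1.
  case: (eqVneq b v) => [bv|nbv].
    have -> : (1 - x v ^+ 2) * Q = (1 - x v) * ((1 + x b) * Q).
      by rewrite bv; ring.
    exact: JM.
  have : J (edge x b (Some v) * Q) by apply: Jedge => _ [<-]; apply: rv.
  rewrite /edge /= => J2.
  have -> : (1 - x v ^+ 2) * Q = (1 + x v) *
      ((1 + x b * x v) * Q + (- x v) * ((1 + x b) * Q)) by ring.
  by apply: (JM); apply: (JD) => //; apply: (JM).
have [b [c [bS cS' rcb]]] :
    exists b c, [/\ b \in S, c \in S & (r c < r b)%N].
  have /card_gt1P [b [c [bS cS' nbc]]] : (1 < #|S|)%N by rewrite cS.
  case: (ltngtP (r b) (r c)) => [lt|lt|/r_inj eq].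
  - by exists c, b.
  - by exists b, c.
  - by rewrite eq eqxx in nbc.
set Q := \prod_(i | _) _.
have Jedge a o : a \in S -> (forall j, o = Some j -> (r j < r a)%N) ->
    J ((1 - x v ^+ 2) * (edge x a o * Q)).
  move=> aS /(join_root x aS pP) [p' p'P <-]; apply: IHn => //.
  by apply/eqP; rewrite -eqSS -cS (cardsD1 a S) aS.
have := Jedge b None bS (none_below b); rewrite /edge /= mulr1 => Jb.
have := Jedge c None cS' (none_below c); rewrite /edge /= mulr1 => Jc.
have : J ((1 - x v ^+ 2) * (edge x b (Some c) * Q)).
  by apply: Jedge => // _ [<-].
rewrite /edge /= => Jbc.
set Y := (X in J X).
have -> : Y = h * 2 * Y by rewrite h2 mul1r.
have -> : h * 2 * Y = h * ((1 - x v ^+ 2) * ((1 + x b * x c) * Q)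
    + ((1 - x v ^+ 2) * ((1 + x c) * Q)
       + (- x c) * ((1 - x v ^+ 2) * ((1 + x b) * Q)))).
  by rewrite /Y; ring.
by apply: (JM); apply: (JD) => //; apply: (JD) => //; apply: (JM).
Qed.

(** * Tree matrices *)

Definition tree_mx (d : nat) (p : 'I_d -> option 'I_d) : 'M[nat]_d :=
  \matrix_(i, j) ((i == j) + (p j == Some i))%N.

(** A permutation with a nonzero term in the Leibniz formula never decreases
    the rank; as the sum of the ranks is preserved, it fixes every rank, and
    then no parent edge can occur in the term. *)
Lemma det_tree_mx (d : nat) (r : 'I_d -> nat) (p : 'I_d -> option 'I_d) :
  parents_below r p -> \det (map_mx Posz (tree_mx p)) = 1.
Proof.
move=> pP; rewrite /determinant (bigD1 (1%g : 'S_d)) //= [X in _ + X]big1 => [|s s_neq1].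
  rewrite addr0 odd_perm1 mul1r big1 // => i _; rewrite !mxE perm1 eqxx.
  by case: eqP => // /pP; rewrite ltnn.
have [/existsP [i /eqP Mi0]|/existsPn Mn0] :=
    boolP [exists i, map_mx Posz (tree_mx p) i (s i) == 0].
  by rewrite (bigD1 i) //= Mi0 mul0r mulr0.
have step i : s i = i \/ (r i < r (s i))%N.
  have := Mn0 i; rewrite !mxE (eq_sym i).
  case: (s i =P i) => [|_]; first by left.
  by case: (p (s i) =P Some i) => [/pP|//]; right.
have le_r i : (r i <= r (s i) ?= iff (r i == r (s i)))%N.
  by split=> //; case: (step i) => [->|/ltnW].
have eq_sum : (\sum_i r i)%N = (\sum_i r (s i))%N.
  by rewrite [LHS](reindex_inj (@perm_inj _ s)).
have := leqif_sum (P := xpredT) (fun i _ => le_r i).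
move=> /leqifP; case: ifP => [/forall_inP eq_r _|_]; last by rewrite eq_sum ltnn.
case/eqP: s_neq1; apply/permP => i; rewrite perm1.
by case: (step i) => // lt; have := eq_r i isT; rewrite (ltn_eqF lt).
Qed.

Lemma X12_pair (d : nat) (j k : 'I_d) : j != k ->
  exists c, forall i, X12 d i c = ((i == j) + (i == k))%N.
Proof.
wlog lt_jk : j k / (j < k)%N => [H njk|_].
  case: (ltngtP j k) (njk) => [lt|lt|/val_inj ->]; last by rewrite eqxx.
    exact: H.
  rewrite eq_sym => /(H _ _ lt) [c cE]; exists c => i.
  by rewrite cE addnC.
pose u : upair d := exist _ (j, k) lt_jk.
exists (rshift d (enum_rank u)) => i.
by rewrite row_mxEr mxE enum_rankK.
Qed.

Lemma tree_mx_column_submatrix (d : nat) (r : 'I_d -> nat)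
    (p : 'I_d -> option 'I_d) :
  parents_below r p -> column_submatrix (X12 d) (tree_mx p).
Proof.
move=> pP.
have ex_col j : exists c, [forall i, X12 d i c == tree_mx p i j].
  case pj: (p j) => [k|].
    have njk : j != k.
      by apply/eqP => jk; have := pP _ _ pj; rewrite jk ltnn.
    have [c cE] := X12_pair njk; exists c; apply/forallP => i.
    rewrite cE mxE pj; apply/eqP; congr (_ + _)%N.
    by congr nat_of_bool; apply/eqP/eqP => [->|[->]].
  exists (lshift _ j); apply/forallP => i.
  by rewrite row_mxEl !mxE pj addn0; case: (i == j).
pose f j := xchoose (ex_col j).
have fE i j : X12 d i (f j) = tree_mx p i j.
  by apply/eqP; move/forallP: (xchooseP (ex_col j)); apply.
exists f; last by apply/matrixP => i j; rewrite [RHS]mxE fE.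
(* Two vertices with equal columns would be each the parent of the other. *)
have lt_r j j' : f j = f j' -> j != j' -> (r j < r j')%N.
  move=> fjj' njj'; have := fE j j; rewrite fjj' fE !mxE eqxx (negbTE njj').
  by case: (p j' =P Some j) => [/pP|].
move=> j j' fjj'; apply/eqP/negPn/negP => njj'.
have := lt_r _ _ (esym fjj'); rewrite eq_sym => /(_ njj').
by rewrite ltnNge ltnW // lt_r.
Qed.

Lemma q_tree_mx (R : realType) (d : nat) (p : 'I_d -> option 'I_d) :
  q R (tree_mx p)
    = (2^-1 ^+ d) *: \prod_i edge (fun i : 'I_d => 'X_i : {mpoly R[d]}) i (p i).
Proof.
rewrite /q scaler_prod prodr_const card_ord; congr (_ *: _).
apply: eq_bigr => j _; congr (1 + _).
under eq_bigr do rewrite mxE exprD.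
rewrite big_split /= (bigD1 j) //= eqxx expr1 big1 ?mulr1 => [|i /negbTE->//].
congr (_ * _); case: (p j) => [k|] /=; last by rewrite big1.
rewrite (bigD1 k) //= eqxx expr1 big1 ?mulr1 // => i nik.
by case: eqP => // - [ki]; rewrite ki eqxx in nik.
Qed.

(** * Interpolation on the cube *)

(** Multiplication by [L] modulo [J] turns each variable into the scalar
    [eps i], hence each polynomial into its value at [eps]. *)
Lemma interpolation_mod_ideal (R : realType) (d : nat) (J : {mpoly R[d]} -> Prop)
    (L : {mpoly R[d]}) (eps : 'I_d -> R) :
    ideal J -> (forall i, J (('X_i - (eps i)%:MP) * L)) ->
  forall p : {mpoly R[d]}, J ((p - (p.@[eps])%:MP) * L).
Proof.
move=> [J0 JD JM] JX.
pose P (p : {mpoly R[d]}) := J ((p - (p.@[eps])%:MP) * L).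
have P1 : P 1 by rewrite /P meval1 subrr mul0r.
have PM p q : P p -> P q -> P (p * q).
  move=> Pp Pq; rewrite /P mevalM mpolyCM.
  have -> : (p * q - (p.@[eps])%:MP * (q.@[eps])%:MP) * L =
      q * ((p - (p.@[eps])%:MP) * L) + (p.@[eps])%:MP * ((q - (q.@[eps])%:MP) * L).
    by ring.
  by apply: (JD); apply: (JM).
elim/mpolyind => [|c m p _ _ Pp]; first by rewrite meval0 mpolyC0 subrr mul0r.
rewrite mevalD mevalZ mpolyCD mpolyCM -mul_mpolyC.
have PXm : P 'X_[m].
  rewrite mpolyXE_id; apply: (big_ind P) => // i _.
  elim: (m i) => [|k IHk]; first by rewrite expr0.
  by rewrite exprS; apply: (PM) => //; rewrite /P mevalXU.
set a := 'X_[m].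
have -> : (c%:MP * a + p - (c%:MP * (a.@[eps])%:MP + (p.@[eps])%:MP)) * L
    = c%:MP * ((a - (a.@[eps])%:MP) * L) + (p - (p.@[eps])%:MP) * L by ring.
by apply: (JD) => //; apply: (JM).
Qed.

(** The indicator polynomial of the vertex of the cube with coordinates
    [(-1) ^+ f i]. *)
Definition cube_idempotent (R : realType) (d : nat) (f : {ffun 'I_d -> bool}) :
    {mpoly R[d]} :=
  \prod_i (2^-1 *: (1 + (-1) ^+ f i * 'X_i)).

Lemma sum_cube_idempotent (R : realType) (d : nat) :
  \sum_(f : {ffun 'I_d -> bool}) cube_idempotent R f = 1.
Proof.
rewrite -(bigA_distr_bigA
  (fun (i : 'I_d) (b : bool) => 2^-1 *: (1 + (-1) ^+ b * 'X_i) : {mpoly R[d]})).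
rewrite big1 // => i _; rewrite big_bool /= -scalerDr expr0 expr1.
have -> : 1 + -1 * 'X_i + (1 + 1 * 'X_i) = 2%:R%:A :> {mpoly R[d]}.
  by rewrite scaler_nat; ring.
by rewrite scalerA mulVf ?scale1r // pnatr_eq0.
Qed.

Lemma mulX_cube_idempotent (R : realType) (d : nat) (J : {mpoly R[d]} -> Prop)
    (f : {ffun 'I_d -> bool}) (i : 'I_d) :
    ideal J -> J (1 - 'X_i ^+ 2) ->
  J (('X_i - ((-1) ^+ f i)%:MP) * cube_idempotent R f).
Proof.
move=> [_ _ JM] Ji; rewrite /cube_idempotent (bigD1 i) //= -mul_mpolyC.
set Q := \prod_(_ | _) _.
rewrite rmorphXn /= mpolyCN mpolyC1.
suff -> : ('X_i - (-1) ^+ f i)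
    * ((2^-1)%:MP * (1 + (-1) ^+ f i * 'X_i) * Q)
    = (- (-1) ^+ f i * (2^-1)%:MP * Q) * (1 - 'X_i ^+ 2) :> {mpoly R[d]}.
  exact: JM.
by case: (f i); rewrite ?expr0 ?expr1; ring.
Qed.

(** * Unimodular matrices and signs *)

(** Raising the values [eps^theta] to the powers given by the adjugate matrix
    recovers each [eps k] up to inversion. *)
Lemma unimodular_signs (F : fieldType) (d : nat) (Theta : 'M[nat]_d)
    (eps : 'I_d -> F) :
    unimodular Theta -> (forall i, eps i != 0) ->
    (forall j, \prod_i eps i ^+ Theta i j = 1) ->
  forall k, eps k = 1.
Proof.
move=> uT eps0 eps1 k; set M := map_mx Posz Theta.
have prodz (I : finType) (g : I -> F) (z : int) :
    (\prod_i g i) ^ z = \prod_i g i ^ z.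
  by apply: (big_morph (fun x => x ^ z)) => [x y|]; rewrite ?expfzMl ?exp1rz.
have zsum (I : finType) (x : F) (g : I -> int) : x != 0 ->
    x ^ (\sum_i g i) = \prod_i x ^ g i.
  move=> x0; apply: (big_morph (fun z : int => x ^ z)) => [y z|].
    by rewrite expfzDr.
  by rewrite expr0z.
have : \prod_j (\prod_i eps i ^+ Theta i j) ^ (\adj M j k) = 1.
  by rewrite big1 // => j _; rewrite eps1 exp1rz.
have -> : \prod_j (\prod_i eps i ^+ Theta i j) ^ (\adj M j k)
    = \prod_i eps i ^ ((M *m \adj M) i k).
  under eq_bigr do rewrite prodz.
  rewrite exchange_big; apply: eq_bigr => i _.
  rewrite mxE zsum //; apply: eq_bigr => j _.
  by rewrite exprnP exprz_exp [M i j]mxE.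
rewrite mul_mx_adj (bigD1 k) //= big1 => [|i nik].
  rewrite mxE eqxx mulr1n mulr1; case: uT => ->; first by rewrite expr1z.
  by rewrite exprN1 => /(congr1 GRing.inv); rewrite invrK invr1.
by rewrite mxE (negbTE nik) mulr0n expr0z.
Qed.

Lemma q_vanishing (R : realType) (d : nat) (Theta : 'M[nat]_d) :
  unimodular Theta -> vanishing_ideal (q R Theta).
Proof.
move=> uT eps eps_sign eps_neq1.
have eps0 i : eps i != 0.
  by case: (eps_sign i) => ->; rewrite ?oppr_eq0 oner_eq0.
rewrite /q rmorph_prod /=; apply/eqP/prodf_eq0.
have [/existsP [j /eqP ej]|/existsPn nej] :=
    boolP [exists j, \prod_i eps i ^+ Theta i j == -1].
  exists j => //; rewrite mevalZ mevalD meval1 rmorph_prod /=.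
  under eq_bigr do rewrite rmorphXn /= mevalXU.
  by rewrite ej subrr mulr0.
case: eps_neq1; apply: (unimodular_signs uT eps0) => j.
have : \prod_i eps i ^+ Theta i j = -1 \/ \prod_i eps i ^+ Theta i j = 1.
  apply: (big_ind (fun x : R => x = -1 \/ x = 1)) => [|x y|i _]; first by right.
    by case=> -> [] ->; rewrite ?mulrNN ?mulr1 ?mul1r; [right|left|left|right].
  case: (eps_sign i) => ->; last by right; rewrite expr1n.
  by rewrite -signr_odd; case: odd; rewrite ?expr0 ?expr1; [left|right].
by case=> // ej; have := nej j; rewrite ej eqxx.
Qed.

(** * The ideal of the punctured cube *)

Theorem theorem2p6 (R : realType) (d : nat) (hd : (1 <= d)%N)
    (p : {mpoly R[d]}) :
  vanishing_ideal p <->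
  generated_ideal
    (fun g : {mpoly R[d]} =>
       exists Theta : 'M[nat]_d,
         [/\ column_submatrix (X12 d) Theta, unimodular Theta & g = q R Theta])
    p.
Proof.
split=> [vp|[n [a [s [Ss ->]]]] eps eps_sign eps_neq1]; last first.
  rewrite rmorph_sum /= big1 // => i _; rewrite mevalM.
  by case: (Ss i) => Theta [_ uT ->]; rewrite q_vanishing ?mulr0.
set J := generated_ideal _.
have idJ : ideal J := generated_ideal_ideal _.
have [J0 JD JM] := idJ.
have Jtree (r : 'I_d -> nat) p' : parents_below r p' ->
    J (\prod_i edge (fun i : 'I_d => 'X_i : {mpoly R[d]}) i (p' i)).
  move=> p'P; have Jq : J (q R (tree_mx p')).
    apply: mem_generated_ideal; exists (tree_mx p'); split=> //.
      exact: tree_mx_column_submatrix p'P.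
    by left; apply: det_tree_mx p'P.
  have := JM (2 ^+ d)%:MP _ Jq; rewrite q_tree_mx mul_mpolyC scalerA -exprMn.
  by rewrite divff ?pnatr_eq0 // expr1n scale1r.
have Jsqr v : J (1 - 'X_v ^+ 2).
  (* Any order works in which v comes before all the other vertices. *)
  pose r (i : 'I_d) := if i == v then 0%N else i.+1.
  apply: (one_sub_sqr_in_tree_ideal (x := fun i => 'X_i) (r := r)
    (h := (2^-1)%:MP)) => //.
  - by rewrite mulr_natr -raddfMn /= -[_^-1 *+ _]mulr_natr mulVf ?mpolyC1 ?pnatr_eq0.
  - move=> i j; rewrite /r; case: eqP => [->|_]; case: eqP => [->|_] //.
    by case=> /val_inj.
  - by move=> i niv; rewrite /r eqxx (negbTE niv).
  - exact: Jtree.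
rewrite -[p]mulr1 -(sum_cube_idempotent R d) mulr_sumr.
apply: (big_ind J) => // f _.
pose eps i : R := (-1) ^+ f i.
have Jpf : J ((p - (p.@[eps])%:MP) * cube_idempotent R f).
  by apply: interpolation_mod_ideal => // i; apply: mulX_cube_idempotent.
suff : J ((p.@[eps])%:MP * cube_idempotent R f).
  by move=> /(JD _ _ Jpf); rewrite -mulrDl subrK.
have [/existsP [i fi]|/existsPn nf] := boolP [exists i, f i].
  rewrite vp ?mpolyC0 ?mul0r // => [j|/(_ i)].
    by rewrite /eps; case: (f j); [left|right].
  rewrite /eps fi expr1 => /eqP; rewrite eq_sym -addr_eq0.
  by rewrite (_ : 1 + 1 = 2%:R) // pnatr_eq0.
apply: (JM); rewrite /cube_idempotent scaler_prod -mul_mpolyC; apply: (JM).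
have := Jtree (fun=> 0%N) (fun=> None); rewrite /edge /= => /(_ _) Jq.
under eq_bigr do rewrite (negbTE (nf _)) expr0 mul1r -['X_ _]mulr1.
exact: Jq.
Qed.
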